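(* The function $K:[0,1]\to\mathbb{R}$ is continuous, but it does not possess a finite derivative at any point of $[0,1]$.
   Context: Okamoto's functions. For $0<a<1$, define $F_a:[0,1]\to[0,1]$ as follows. Let $f_0(x)=x$ and, inductively for $n=0,1,2,\dots$, let $f_{n+1}$ be the unique continuous function on $[0,1]$ which is linear on each interval $[j/3^{n+1},(j+1)/3^{n+1}]$ ($j=0,\dots,3^{n+1}-1$) and satisfies, for $k=0,1,\dots,3^n-1$, $$f_{n+1}(k/3^n)=f_n(k/3^n),\qquad f_{n+1}((k+1)/3^n)=f_n((k+1)/3^n),$$ $$f_{n+1}((3k+1)/3^{n+1})=f_n(k/3^n)+a\,[f_n((k+1)/3^n)-f_n(k/3^n)],$$ $$f_{n+1}((3k+2)/3^{n+1})=f_n(k/3^n)+(1-a)\,[f_n((k+1)/3^n)-f_n(k/3^n)].$$ The sequence $(f_n)$ converges uniformly on $[0,1]$, and $F_a:=\lim_{n\to\infty}f_n$. In particular $F_{1/3}(x)=x$. For each fixed $x\in[0,1]$ the function $a\mapsto F_a(x)$ is differentiable on $(0,1)$. The function $K:[0,1]\to\mathbb{R}$ is defined by $$K(x):=\left.\frac{\partial F_a(x)}{\partial a}\right|_{a=1/3}.$$ At the endpoints $x=0$ and $x=1$ the derivative is understood as the one-sided derivative (limit of difference quotients over $h$ with $x+h\in[0,1]$). *)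

(* Defs.v *)
From Stdlib Require Import Reals Lra Lia Psatz ZArith.
From Coquelicot Require Import Coquelicot.
Open Scope R_scope.

Definition unit_interval (x : R) : Prop := 0 <= x <= 1.

Definition triadic (n : nat) (j : Z) : R := IZR j / 3 ^ n.

(* The function that takes the value [y j] at j / 3^n for every integer j and
   is affine between consecutive points of the grid. *)
Definition interpolate (n : nat) (y : Z -> R) (x : R) : R :=
  let j := Int_part (3 ^ n * x) in
  y j + (3 ^ n * x - IZR j) * (y (j + 1)%Z - y j).

(* The values prescribed for f_(n+1) at the points m / 3^(n+1), given f = f_n. *)
Definition next_values (a : R) (n : nat) (f : R -> R) (m : Z) : R :=
  let k := (m / 3)%Z in
  let u := f (triadic n k) in
  let v := f (triadic n (k + 1)) in
  match (m mod 3)%Z with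
  | 0%Z => u
  | 1%Z => u + a * (v - u)
  | _ => u + (1 - a) * (v - u)
  end.

(* Only the values on [0, 1] matter; okamoto_approx_is_step and
   is_okamoto_step_unique below show that there this is the sequence obtained
   from the inductive description [is_okamoto_step]. *)
Fixpoint okamoto_approx (a : R) (n : nat) : R -> R :=
  match n with
  | O => fun x => x
  | S m => interpolate (S m) (next_values a m (okamoto_approx a m))
  end.

Definition okamoto (a x : R) : R :=
  real (Lim_seq (fun n => okamoto_approx a n x)).

Definition K (x : R) : R := Derive (fun a => okamoto a x) (1 / 3).

(* [l] is the derivative at [x] of [f] as a function on the set [D]; at an
   endpoint of an interval this is the one-sided derivative. *)
Definition is_derive_within (D : R -> Prop) (f : R -> R) (x l : R) : Prop :=
  filterlim (fun h => (f (x + h) - f x) / h)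
    (within (fun h => h <> 0 /\ D (x + h)) (locally 0)) (locally l).

Record is_okamoto_step (a : R) (n : nat) (f g : R -> R) : Prop := {
  step_continuous : continuous_on unit_interval g;
  step_linear : forall j : Z, (0 <= j < 3 ^ Z.of_nat (S n))%Z ->
    exists p q : R, forall x : R,
      triadic (S n) j <= x <= triadic (S n) (j + 1) -> g x = p * x + q;
  step_left : forall k : Z, (0 <= k < 3 ^ Z.of_nat n)%Z ->
    g (triadic n k) = f (triadic n k);
  step_right : forall k : Z, (0 <= k < 3 ^ Z.of_nat n)%Z ->
    g (triadic n (k + 1)) = f (triadic n (k + 1));
  step_one : forall k : Z, (0 <= k < 3 ^ Z.of_nat n)%Z ->
    g (triadic (S n) (3 * k + 1)) =
      f (triadic n k) + a * (f (triadic n (k + 1)) - f (triadic n k));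
  step_two : forall k : Z, (0 <= k < 3 ^ Z.of_nat n)%Z ->
    g (triadic (S n) (3 * k + 2)) =
      f (triadic n k) + (1 - a) * (f (triadic n (k + 1)) - f (triadic n k))
}.

Lemma pow3_pos (n : nat) : 0 < 3 ^ n.
Proof. apply pow_lt; lra. Qed.

Lemma pow3_triadic (n : nat) (j : Z) : 3 ^ n * triadic n j = IZR j.
Proof. unfold triadic; field; apply Rgt_not_eq, pow3_pos. Qed.

Lemma triadic_S (n : nat) (k : Z) : triadic (S n) (3 * k) = triadic n k.
Proof.
unfold triadic; rewrite mult_IZR; simpl; field; apply Rgt_not_eq, pow3_pos.
Qed.

Lemma le_triadic (n : nat) (j : Z) (x : R) :
  triadic n j <= x <-> IZR j <= 3 ^ n * x.
Proof.
rewrite <- (pow3_triadic n j); generalize (pow3_pos n); intros H; split; nra.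
Qed.

Lemma triadic_le (n : nat) (j : Z) (x : R) :
  x <= triadic n j <-> 3 ^ n * x <= IZR j.
Proof.
rewrite <- (pow3_triadic n j); generalize (pow3_pos n); intros H; split; nra.
Qed.

Lemma interpolate_piece (n : nat) (y : Z -> R) (j : Z) (x : R) :
  IZR j <= 3 ^ n * x <= IZR (j + 1) ->
  interpolate n y x = y j + (3 ^ n * x - IZR j) * (y (j + 1)%Z - y j).
Proof.
intros [H1 H2]; unfold interpolate; rewrite plus_IZR in H2.
destruct (Rle_lt_or_eq_dec _ _ H2) as [H3 | H3].
- rewrite <- (Int_part_spec (3 ^ n * x) j) by lra; reflexivity.
- rewrite <- (Int_part_spec (3 ^ n * x) (j + 1)) by (rewrite plus_IZR; lra).
  rewrite H3, plus_IZR; ring.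
Qed.

Lemma interpolate_triadic (n : nat) (y : Z -> R) (j : Z) :
  interpolate n y (triadic n j) = y j.
Proof.
rewrite (interpolate_piece n y j); rewrite pow3_triadic.
- ring.
- rewrite plus_IZR; lra.
Qed.

Lemma interpolate_continuous (n : nat) (y : Z -> R) (x : R) :
  continuous (interpolate n y) x.
Proof.
set (j := Int_part (3 ^ n * x)).
destruct (base_Int_part (3 ^ n * x)) as [H1 H2]; fold j in H1, H2.
set (L := fun i t => y i + (3 ^ n * t - IZR i) * (y (i + 1)%Z - y i)).
assert (cL : forall i, continuous (L i) x).
{ intros i; apply (ex_derive_continuous (L i)); unfold L; auto_derive; auto. }
assert (cz : continuous (fun t => 3 ^ n * t) x).
{ apply (ex_derive_continuous (fun t => 3 ^ n * t)); auto_derive; auto. }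
assert (Hj : interpolate n y x = L j x) by reflexivity.
destruct (Rle_lt_or_eq_dec _ _ H1) as [H3 | H3].
- apply continuous_ext_loc with (g := L j); [| apply cL].
  assert (H : locally x (fun t => IZR j < 3 ^ n * t < IZR j + 1)).
  { apply (cz (fun z => IZR j < z < IZR j + 1)).
    apply (locally_interval _ _ (IZR j) (IZR j + 1)); simpl; try lra.
    intros; lra. }
  apply filter_imp with (2 := H); intros t Ht.
  symmetry; apply interpolate_piece; rewrite plus_IZR; lra.
- assert (Hj' : interpolate n y x = L (j - 1)%Z x).
  { apply interpolate_piece.
    replace (j - 1 + 1)%Z with j by lia; rewrite minus_IZR; lra. }
  intros P HP.
  assert (P1 := cL j P); rewrite <- Hj in P1; specialize (P1 HP).
  assert (P2 := cL (j - 1)%Z P); rewrite <- Hj' in P2; specialize (P2 HP).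
  assert (H : locally x (fun t => IZR j - 1 < 3 ^ n * t < IZR j + 1)).
  { apply (cz (fun z => IZR j - 1 < z < IZR j + 1)).
    apply (locally_interval _ _ (IZR j - 1) (IZR j + 1)); simpl; try lra.
    intros; lra. }
  unfold filtermap in *.
  generalize (filter_and _ _ H (filter_and _ _ P1 P2)); apply filter_imp.
  intros t [Ht [Q1 Q2]].
  destruct (Rle_dec (IZR j) (3 ^ n * t)) as [H4 | H4].
  + rewrite (interpolate_piece n y j); [exact Q1 | rewrite plus_IZR; lra].
  + rewrite (interpolate_piece n y (j - 1)); [exact Q2 |].
    replace (j - 1 + 1)%Z with j by lia; rewrite minus_IZR; lra.
Qed.

Lemma okamoto_approx_S (a : R) (n : nat) :
  okamoto_approx a (S n) =
  interpolate (S n) (next_values a n (okamoto_approx a n)).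
Proof. reflexivity. Qed.

Lemma okamoto_approx_is_step (a : R) (n : nat) :
  is_okamoto_step a n (okamoto_approx a n) (okamoto_approx a (S n)).
Proof.
assert (E : forall k r, (0 <= r < 3)%Z ->
          ((3 * k + r) / 3 = k)%Z /\ ((3 * k + r) mod 3 = r)%Z).
{ intros k r Hr; split.
  - symmetry; apply (Z.div_unique _ _ k r); lia.
  - symmetry; apply (Z.mod_unique _ _ k r); lia. }
assert (H0 : forall k,
          okamoto_approx a (S n) (triadic n k) = okamoto_approx a n (triadic n k)).
{ intros k; rewrite <- (triadic_S n k) at 1; rewrite okamoto_approx_S.
  rewrite interpolate_triadic; unfold next_values.
  destruct (E k 0%Z) as [E1 E2]; [lia |].
  rewrite Z.add_0_r in E1, E2; now rewrite E1, E2. }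
split; try (intros k _; now apply H0).
- apply continuous_on_forall; intros x _; apply interpolate_continuous.
- intros j _; rewrite okamoto_approx_S.
  set (y := next_values _ _ _).
  exists (3 ^ S n * (y (j + 1)%Z - y j)), (y j - IZR j * (y (j + 1)%Z - y j)).
  intros x [H1 H2]; apply le_triadic in H1; apply triadic_le in H2.
  rewrite (interpolate_piece _ y j) by (split; assumption); ring.
- intros k _; rewrite okamoto_approx_S; rewrite interpolate_triadic.
  unfold next_values; destruct (E k 1%Z) as [-> ->]; [lia | reflexivity].
- intros k _; rewrite okamoto_approx_S; rewrite interpolate_triadic.
  unfold next_values; destruct (E k 2%Z) as [-> ->]; [lia | reflexivity].
Qed.

Lemma is_okamoto_step_unique (a : R) (n : nat) (f f' g g' : R -> R) :
  (forall x, unit_interval x -> f x = f' x) ->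
  is_okamoto_step a n f g -> is_okamoto_step a n f' g' ->
  forall x, unit_interval x -> g x = g' x.
Proof.
intros Hf G G'.
set (N := (3 ^ Z.of_nat n)%Z).
assert (HN : IZR N = 3 ^ n) by (unfold N; symmetry; apply pow_IZR).
assert (HSN : (3 ^ Z.of_nat (S n) = 3 * N)%Z).
{ unfold N; rewrite Nat2Z.inj_succ, Z.pow_succ_r; lia. }
assert (Npos : (0 < N)%Z) by (apply lt_IZR; rewrite HN; apply pow3_pos).
assert (U : forall k, (0 <= k <= N)%Z -> f (triadic n k) = f' (triadic n k)).
{ intros k [H1 H2]; apply Hf; split.
  - unfold triadic; apply Rmult_le_pos; [now apply IZR_le |].
    left; apply Rinv_0_lt_compat, pow3_pos.
  - apply Rmult_le_reg_l with (3 ^ n); [apply pow3_pos |].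
    rewrite pow3_triadic, Rmult_1_r, <- HN; now apply IZR_le. }
assert (V : forall m, (0 <= m <= 3 * N)%Z ->
          g (triadic (S n) m) = g' (triadic (S n) m)).
{ intros m Hm.
  assert (D := Z.div_mod m 3 ltac:(lia)).
  assert (M := Z.mod_pos_bound m 3 ltac:(lia)).
  set (k := (m / 3)%Z) in *; set (r := (m mod 3)%Z) in *.
  destruct (Z.eq_dec m (3 * N)) as [-> | Hlt].
  - rewrite triadic_S; replace N with (N - 1 + 1)%Z by lia.
    rewrite (step_right _ _ _ _ G), (step_right _ _ _ _ G') by (fold N; lia).
    apply U; lia.
  - assert (Hk : (0 <= k < N)%Z) by lia.
    assert (Hr : r = 0%Z \/ r = 1%Z \/ r = 2%Z) by lia.
    rewrite D; destruct Hr as [-> | [-> | ->]].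
    + rewrite Z.add_0_r, triadic_S.
      rewrite (step_left _ _ _ _ G), (step_left _ _ _ _ G') by exact Hk.
      apply U; lia.
    + rewrite (step_one _ _ _ _ G), (step_one _ _ _ _ G') by exact Hk.
      rewrite !U by lia; reflexivity.
    + rewrite (step_two _ _ _ _ G), (step_two _ _ _ _ G') by exact Hk.
      rewrite !U by lia; reflexivity. }
assert (W : forall m x, (0 <= m < 3 * N)%Z ->
          IZR m <= 3 ^ S n * x <= IZR (m + 1) -> g x = g' x).
{ intros m x Hm [H1 H2].
  destruct (step_linear _ _ _ _ G m) as (p & q & L); [lia |].
  destruct (step_linear _ _ _ _ G' m) as (p' & q' & L'); [lia |].
  assert (V1 := V m ltac:(lia)); assert (V2 := V (m + 1)%Z ltac:(lia)).
  assert (T : triadic (S n) m < triadic (S n) (m + 1)).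
  { unfold triadic; apply Rmult_lt_compat_r; [apply Rinv_0_lt_compat, pow3_pos |].
    apply IZR_lt; lia. }
  rewrite L, L' in V1 by lra; rewrite L, L' in V2 by lra.
  apply le_triadic in H1; apply triadic_le in H2.
  rewrite L, L' by lra.
  assert (p = p') by nra; subst p'; nra. }
intros x [Hx0 Hx1].
assert (P := pow3_pos (S n)).
assert (HN3 : IZR (3 * N) = 3 ^ S n) by (rewrite mult_IZR, HN; reflexivity).
destruct (base_Int_part (3 ^ S n * x)) as [B1 B2].
set (j := Int_part (3 ^ S n * x)) in *.
destruct (Rle_lt_or_eq_dec _ _ Hx1) as [Hlt | ->].
- apply (W j); [split | rewrite plus_IZR; lra].
  + assert (IZR (-1) < IZR j) by (assert (0 <= 3 ^ S n * x) by nra; simpl; lra).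
    apply lt_IZR in H; lia.
  + apply lt_IZR; rewrite HN3; nra.
- apply (W (3 * N - 1)%Z); [lia |].
  replace (3 * N - 1 + 1)%Z with (3 * N)%Z by lia.
  rewrite minus_IZR, HN3; lra.
Qed.

(* Main.v *)
Require Import Defs.
From Stdlib Require Import Reals Lra Lia ZArith.
From Coquelicot Require Import Coquelicot.
Open Scope R_scope.

(** Put h = a - 1/3.  On a triadic interval of level n the approximation
    [okamoto_approx a n] is affine, and passing to level n + 1 adds to it h
    times its rise over the interval times one arch of a fixed 1-periodic
    zigzag phi with the values 0, 1, -1, 0 at 0, 1/3, 2/3, 1
    ([approx_S_sub]).  The rises are products of factors 1/3 + h or 1/3 - 2h,
    hence tend to 3^-n as h tends to 0, with an error summable in n.  Summing
    over n gives

      F_a(x) = x + h * sum_n 3^-n phi(3^n x) + O(h^2)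

    uniformly in x ([okamoto_expansion]), so K is the Takagi-like series
    sum_n 3^-n phi(3^n x).  This series converges normally, hence K is
    continuous.

    Non-differentiability is arithmetic.  At a triadic point F_a is a
    polynomial in a ([okamoto_triadic]); differentiating the product formula
    for the rises shows that the slope of K over a triadic interval of level n
    is 3 s, where s is a sum of n terms 1 or -2, one for each factor.  Since
    both are 1 modulo 3, s is congruent to n modulo 3 ([slope_mod_3]).  A
    finite derivative at x would be the limit of the slopes over triadic
    intervals containing x ([derive_within_straddle]); but the integers s of
    two consecutive levels are always distinct, so that these slopes keep
    differing by at least 3. *)

(** * The zigzag and one step of the construction *)

Definition zig (m : Z) : Z :=
  match (m mod 3)%Z with 0%Z => 0 | 1%Z => 1 | _ => -1 end%Z.

Definition zig_step (m : Z) : Z := (zig (m + 1) - zig m)%Z.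

(** The 1-periodic function phi with phi(0) = phi(1) = 0, phi(1/3) = 1 and
    phi(2/3) = -1, affine on each third; its slopes are 3, -6, 3. *)
Definition zigzag (t : R) : R := interpolate 1 (fun m => IZR (zig m)) t.

Lemma div_mod_3 (k r : Z) :
  (0 <= r < 3)%Z -> ((3 * k + r) / 3 = k)%Z /\ ((3 * k + r) mod 3 = r)%Z.
Proof.
intros Hr; split.
- symmetry; apply (Z.div_unique _ _ k r); lia.
- symmetry; apply (Z.mod_unique _ _ k r); lia.
Qed.

Lemma Z_mod3_cases (m : Z) :
  exists k r : Z, m = (3 * k + r)%Z /\ (r = 0 \/ r = 1 \/ r = 2)%Z.
Proof.
exists (m / 3)%Z, (m mod 3)%Z; split.
- apply Z.div_mod; lia.
- generalize (Z.mod_pos_bound m 3); lia.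
Qed.

Lemma zig_add (k r : Z) : (0 <= r < 3)%Z -> zig (3 * k + r) = zig r.
Proof.
intros Hr; unfold zig.
destruct (div_mod_3 k r Hr) as [_ ->]; now rewrite (Z.mod_small r 3).
Qed.

Lemma zig_step_add (k r : Z) :
  (r = 0 \/ r = 1 \/ r = 2)%Z -> zig_step (3 * k + r) = zig_step r.
Proof.
intros Hr; unfold zig_step; rewrite (zig_add k r) by lia.
destruct Hr as [-> | [-> | ->]].
- now rewrite <- Z.add_assoc, zig_add by lia.
- now rewrite <- Z.add_assoc, zig_add by lia.
- replace (3 * k + 2 + 1)%Z with (3 * (k + 1) + 0)%Z by lia.
  now rewrite zig_add by lia.
Qed.

Lemma zig_step_cases (m : Z) : zig_step m = 1%Z \/ zig_step m = (-2)%Z.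
Proof.
destruct (Z_mod3_cases m) as (k & r & -> & Hr); rewrite zig_step_add by exact Hr.
destruct Hr as [-> | [-> | ->]]; auto.
Qed.

Lemma zig_bound (m : Z) : -1 <= IZR (zig m) <= 1.
Proof.
unfold zig; destruct (m mod 3)%Z as [| [] |]; lra.
Qed.

Lemma zigzag_bound (t : R) : Rabs (zigzag t) <= 1.
Proof.
unfold zigzag, interpolate.
destruct (base_Int_part (3 ^ 1 * t)) as [H1 H2].
set (j := Int_part _) in *.
assert (B := zig_bound j); assert (B' := zig_bound (j + 1)).
apply Rabs_le; split; nra.
Qed.

Lemma zigzag_IZR (j : Z) : zigzag (IZR j) = 0.
Proof.
replace (IZR j) with (triadic 1 (3 * j)).
2: now rewrite triadic_S; unfold triadic; simpl; field.
unfold zigzag; rewrite interpolate_triadic.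
now rewrite <- (Z.add_0_r (3 * j)), zig_add by lia.
Qed.

(** * The increments of the approximations *)

Definition rise (a : R) (n : nat) (k : Z) : R :=
  okamoto_approx a n (triadic n (k + 1)) - okamoto_approx a n (triadic n k).

Lemma approx_affine (a : R) (n : nat) (k : Z) (x : R) :
  IZR k <= 3 ^ n * x <= IZR (k + 1) ->
  okamoto_approx a n x =
  okamoto_approx a n (triadic n k) + (3 ^ n * x - IZR k) * rise a n k.
Proof.
intros H; unfold rise; destruct n as [| n].
- simpl; unfold triadic; rewrite plus_IZR; simpl; field.
- rewrite okamoto_approx_S, !interpolate_triadic.
  now apply interpolate_piece.
Qed.

(** The three rules of the construction in one formula: the coefficients
    0, a, 1 - a, 1 are r/3 + (a - 1/3) zig r for r = 0, 1, 2, 3.  The last case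
    is the right endpoint, which belongs to the next interval. *)
Lemma approx_S_triadic (a : R) (n : nat) (k r : Z) :
  (r = 0 \/ r = 1 \/ r = 2 \/ r = 3)%Z ->
  okamoto_approx a (S n) (triadic (S n) (3 * k + r)) =
  okamoto_approx a n (triadic n k) +
    (IZR r / 3 + (a - 1 / 3) * IZR (zig r)) * rise a n k.
Proof.
intros Hr; rewrite okamoto_approx_S, interpolate_triadic.
unfold next_values, rise.
destruct Hr as [-> | [-> | [-> | ->]]].
- destruct (div_mod_3 k 0) as [-> ->]; [lia |];
    change (zig 0) with 0%Z; simpl; field.
- destruct (div_mod_3 k 1) as [-> ->]; [lia |];
    change (zig 1) with 1%Z; simpl; field.
- destruct (div_mod_3 k 2) as [-> ->]; [lia |];
    change (zig 2) with (-1)%Z; simpl; field.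
- replace (3 * k + 3)%Z with (3 * (k + 1) + 0)%Z by lia.
  destruct (div_mod_3 (k + 1) 0) as [-> ->]; [lia |];
    change (zig 3) with 0%Z; simpl; field.
Qed.

Lemma rise_0 (a : R) (k : Z) : rise a 0 k = 1.
Proof. unfold rise, triadic; simpl; rewrite plus_IZR; field. Qed.

Lemma rise_S (a : R) (n : nat) (m : Z) :
  rise a (S n) m = (1 / 3 + (a - 1 / 3) * IZR (zig_step m)) * rise a n (m / 3).
Proof.
destruct (Z_mod3_cases m) as (k & r & -> & Hr).
rewrite zig_step_add by exact Hr.
destruct (div_mod_3 k r) as [-> _]; [lia |].
unfold rise at 1; rewrite <- Z.add_assoc, !approx_S_triadic by lia.
unfold zig_step; rewrite minus_IZR, plus_IZR; field.
Qed.

(** Both approximations are affine on each third of an interval of level n,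
    and their difference at the four division points is (a - 1/3) times the
    rise times 0, 1, -1, 0, the values of [zigzag]. *)
Lemma approx_S_sub (a : R) (n : nat) (x : R) :
  okamoto_approx a (S n) x - okamoto_approx a n x =
  (a - 1 / 3) * (rise a n (Int_part (3 ^ n * x)) * zigzag (3 ^ n * x)).
Proof.
set (m := Int_part (3 ^ S n * x)).
destruct (base_Int_part (3 ^ S n * x)) as [H1 H2]; fold m in H1, H2.
destruct (Z_mod3_cases m) as (k & r & E & Hr).
assert (E3 : 3 ^ S n * x = 3 * (3 ^ n * x)) by (simpl; ring).
assert (Em : IZR m = 3 * IZR k + IZR r) by now rewrite E, plus_IZR, mult_IZR.
assert (Br : 0 <= IZR r <= 2).
{ split; [apply (IZR_le 0) | apply (IZR_le _ 2)]; lia. }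
assert (Hk : IZR k <= 3 ^ n * x < IZR k + 1) by lra.
rewrite <- (Int_part_spec (3 ^ n * x) k) by lra.
rewrite (approx_affine a (S n) m) by (rewrite plus_IZR; lra).
rewrite (approx_affine a n k) by (rewrite plus_IZR; lra).
unfold zigzag; rewrite (interpolate_piece 1 _ m) by (rewrite plus_IZR; simpl; lra).
rewrite rise_S, E, approx_S_triadic, <- Z.add_assoc by lia.
destruct (div_mod_3 k r) as [-> _]; [lia |].
rewrite zig_step_add by exact Hr.
(* For r = 2 the right end of the third starts the next block; going through
   the step, which depends on r only, avoids a case distinction. *)
replace (zig (3 * k + (r + 1))) with (zig_step r + zig (3 * k + r))%Z.
2: rewrite <- (zig_step_add k) by exact Hr; unfold zig_step;
   rewrite Z.add_assoc; lia.
rewrite zig_add by lia.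
rewrite E3, plus_IZR, !plus_IZR, mult_IZR; simpl; field.
Qed.

Lemma approx_sum (a : R) (n : nat) (x : R) :
  okamoto_approx a (S n) x =
  x + (a - 1 / 3) *
    sum_n (fun i => rise a i (Int_part (3 ^ i * x)) * zigzag (3 ^ i * x)) n.
Proof.
induction n as [| n IH].
- rewrite sum_O; generalize (approx_S_sub a 0 x); simpl; lra.
- rewrite sum_Sn; change (@plus _) with Rplus.
  generalize (approx_S_sub a (S n) x); rewrite IH; lra.
Qed.

(** * Expansion at the parameter 1/3 *)

(** For |h| <= 1/12 every factor is at most 1/2 in absolute value, which gives
    the recurrence e' <= e / 2 + 2 |h| 3^-n for the errors; the bound stated
    here is the solution of that recurrence. *)
Lemma rise_near (a : R) (n : nat) (k : Z) :
  Rabs (a - 1 / 3) <= 1 / 12 ->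
  Rabs (rise a n k - (/ 3) ^ n) <=
  12 * Rabs (a - 1 / 3) * ((/ 2) ^ n - (/ 3) ^ n).
Proof.
intros Ha; set (h := a - 1 / 3) in *; revert k.
induction n as [| n IH]; intros k.
- rewrite rise_0; simpl; rewrite !Rminus_diag, Rabs_R0; lra.
- rewrite rise_S; fold h; specialize (IH (k / 3)%Z).
  set (d := rise a n (k / 3)) in *.
  set (w := IZR (zig_step k)).
  assert (Hw : Rabs (h * w) <= 2 * Rabs h).
  { rewrite Rabs_mult, Rmult_comm; apply Rmult_le_compat_r; [apply Rabs_pos |].
    unfold w; destruct (zig_step_cases k) as [-> | ->]; apply Rabs_le; lra. }
  assert (Hp : Rabs (1 / 3 + h * w) <= / 2).
  { apply Rle_trans with (1 := Rabs_triang _ _).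
    rewrite (Rabs_pos_eq (1 / 3)) by lra; lra. }
  assert (P3 : 0 < (/ 3) ^ n) by (apply pow_lt; lra).
  simpl pow.
  replace ((1 / 3 + h * w) * d - / 3 * (/ 3) ^ n)
    with ((1 / 3 + h * w) * (d - (/ 3) ^ n) + h * w * (/ 3) ^ n) by field.
  apply Rle_trans with (1 := Rabs_triang _ _).
  rewrite !(Rabs_mult _ (d - _)), !(Rabs_mult _ (_ ^ n)), (Rabs_pos_eq (_ ^ n)) by lra.
  assert (A := Rmult_le_compat _ _ _ _ (Rabs_pos _) (Rabs_pos _) Hp IH).
  assert (B := Rmult_le_compat_r _ _ _ (Rlt_le _ _ P3) Hw).
  lra.
Qed.

(** A Takagi-like function, to be identified with [K]. *)
Definition zigzag_series (x : R) : R :=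
  Series (fun n => (/ 3) ^ n * zigzag (3 ^ n * x)).

Lemma zigzag_term_bound (n : nat) (x : R) :
  Rabs ((/ 3) ^ n * zigzag (3 ^ n * x)) <= (/ 3) ^ n.
Proof.
assert (P3 : 0 < (/ 3) ^ n) by (apply pow_lt; lra).
rewrite Rabs_mult, (Rabs_pos_eq (_ ^ n)) by lra.
generalize (zigzag_bound (3 ^ n * x)); nra.
Qed.

Lemma ex_series_geom (q : R) : Rabs q < 1 -> ex_series (fun n => q ^ n).
Proof. intros H; eexists; now apply is_series_geom. Qed.

Lemma ex_series_dominated (a b : nat -> R) :
  (forall n, Rabs (a n) <= b n) -> ex_series b -> ex_series a.
Proof. apply (@ex_series_le R_AbsRing R_CompleteNormedModule). Qed.

Lemma ex_zigzag_series (x : R) :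
  ex_series (fun n => (/ 3) ^ n * zigzag (3 ^ n * x)).
Proof.
apply (ex_series_dominated _ (fun n => (/ 3) ^ n)).
- intros n; apply zigzag_term_bound.
- apply ex_series_geom; rewrite Rabs_pos_eq; lra.
Qed.

(** Every factor in the product formula for the rises is off its value 1/3 by
    at most 2 |h|, so [rise_near] bounds the n-th term of the difference of the
    two series by 12 |h| 2^-n. *)
Lemma okamoto_expansion (a x : R) :
  Rabs (a - 1 / 3) <= 1 / 12 ->
  Rabs (okamoto a x - x - (a - 1 / 3) * zigzag_series x) <=
  24 * (a - 1 / 3) ^ 2.
Proof.
intros Ha.
set (h := a - 1 / 3).
set (u := fun i => rise a i (Int_part (3 ^ i * x)) * zigzag (3 ^ i * x)).
set (v := fun n => (/ 3) ^ n * zigzag (3 ^ n * x)).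
set (g := fun n => 12 * Rabs h * (/ 2) ^ n).
assert (Hh := Rabs_pos h).
assert (G2 : Rabs (/ 2) < 1) by (rewrite Rabs_pos_eq; lra).
assert (D : forall n, Rabs (u n - v n) <= g n).
{ intros n; unfold u, v, g.
  rewrite <- Rmult_minus_distr_r, Rabs_mult.
  assert (R1 := rise_near a n (Int_part (3 ^ n * x)) Ha); fold h in R1.
  assert (R2 := zigzag_bound (3 ^ n * x)).
  assert (P3 : 0 < (/ 3) ^ n) by (apply pow_lt; lra).
  assert (A := Rmult_le_compat _ _ _ _ (Rabs_pos _) (Rabs_pos _) R1 R2).
  nra. }
assert (Sg : is_series g (24 * Rabs h)).
{ replace (24 * Rabs h) with (12 * Rabs h * / (1 - / 2)) by field.
  apply (@is_series_scal R_AbsRing R_NormedModule (12 * Rabs h) (fun n => (/ 2) ^ n)).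
  now apply is_series_geom. }
assert (Eg : ex_series g) by (eexists; exact Sg).
assert (Ed : ex_series (fun n => u n - v n)) by (now apply (ex_series_dominated _ g)).
assert (Ev : ex_series v) by apply ex_zigzag_series.
assert (Eu : ex_series u).
{ apply (ex_series_ext (fun n => plus (u n - v n) (v n))).
  - intros n; unfold plus; simpl; ring.
  - now apply (ex_series_plus (fun n => u n - v n) v). }
assert (F : okamoto a x = x + h * Series u).
{ unfold okamoto; apply (f_equal real (y := Finite (x + h * Series u))).
  apply is_lim_seq_unique, is_lim_seq_incr_1.
  apply (is_lim_seq_ext (fun n => x + h * sum_n u n)).
  - intros n; now rewrite approx_sum.
  - apply (is_lim_seq_plus' (fun _ => x)); [apply is_lim_seq_const |].
    apply (is_lim_seq_scal_l _ h (Series u)).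
    exact (Series_correct u Eu). }
assert (B : Rabs (Series u - Series v) <= 24 * Rabs h).
{ rewrite <- Series_minus, <- (is_series_unique _ _ Sg) by assumption.
  apply Rle_trans with (Series (fun n => Rabs (u n - v n))).
  - apply Series_Rabs, (ex_series_dominated _ g); [| exact Eg].
    intros n; rewrite Rabs_Rabsolu; apply D.
  - apply Series_le; [| exact Eg].
    intros n; split; [apply Rabs_pos | apply D]. }
rewrite F; unfold zigzag_series; fold v.
replace (x + h * Series u - x - h * Series v)
  with (h * (Series u - Series v)) by ring.
rewrite Rabs_mult, <- (pow2_abs h).
assert (A := Rmult_le_compat_l _ _ _ Hh B); simpl; lra.
Qed.

Lemma is_derive_of_quadratic_error (f : R -> R) (a l r C : R) :
  0 < r ->
  (forall b, Rabs (b - a) <= r ->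
     Rabs (f b - f a - (b - a) * l) <= C * (b - a) ^ 2) ->
  is_derive f a l.
Proof.
intros Hr H; apply is_derive_Reals; intros eps Heps.
assert (HC := Rabs_pos C).
assert (P : 0 < Rmin r (eps / (Rabs C + 1))).
{ apply Rmin_pos; [exact Hr | apply Rdiv_lt_0_compat; lra]. }
exists (mkposreal _ P); simpl; intros h h0 Hh.
assert (h1 : Rabs h < r) by (apply Rlt_le_trans with (1 := Hh), Rmin_l).
assert (h2 : Rabs h < eps / (Rabs C + 1)).
{ apply Rlt_le_trans with (1 := Hh), Rmin_r. }
assert (Q : Rabs (f (a + h) - f a - h * l) <= C * h ^ 2).
{ replace h with (a + h - a) at 2 3 by ring.
  apply H; replace (a + h - a) with h by ring; lra. }
assert (hp := Rabs_pos_lt h h0).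
replace ((f (a + h) - f a) / h - l) with ((f (a + h) - f a - h * l) / h)
  by (field; exact h0).
rewrite Rabs_div by exact h0.
apply Rlt_div_l; [exact hp |].
apply Rlt_div_r in h2; [| lra].
rewrite <- (pow2_abs h) in Q.
assert (C <= Rabs C) by apply Rle_abs.
nra.
Qed.

Lemma is_derive_okamoto (x : R) :
  is_derive (fun a => okamoto a x) (1 / 3) (zigzag_series x).
Proof.
assert (E0 : okamoto (1 / 3) x = x).
{ assert (E := okamoto_expansion (1 / 3) x).
  rewrite Rminus_diag, Rabs_R0 in E; specialize (E ltac:(lra)).
  assert (Q := Rabs_pos (okamoto (1 / 3) x - x - 0 * zigzag_series x)).
  simpl in E.
  assert (Z : okamoto (1 / 3) x - x - 0 * zigzag_series x = 0).
  { apply Rabs_eq_0; lra. }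
  lra. }
apply (is_derive_of_quadratic_error _ _ _ (1 / 12) 24); [lra |].
intros b Hb; rewrite E0; now apply okamoto_expansion.
Qed.

Lemma K_eq (x : R) : K x = zigzag_series x.
Proof. apply is_derive_unique, is_derive_okamoto. Qed.

(** * Continuity *)

(** The Weierstrass test, for a series dominated on the whole line. *)
Lemma continuous_Series (f : nat -> R -> R) (M : nat -> R) (x : R) :
  (forall n t, Rabs (f n t) <= M n) -> ex_series M ->
  (forall n t, continuous (f n) t) ->
  continuous (fun t => Series (fun n => f n t)) x.
Proof.
intros HM EM Hc.
assert (T : forall n m t, (n <= m)%nat ->
  Rabs (sum_n (fun k => f k t) m - sum_n (fun k => f k t) n) <=
  sum_n M m - sum_n M n).
{ intros n m t Hnm; induction Hnm as [| m Hnm IH].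
  - rewrite !Rminus_diag, Rabs_R0; lra.
  - rewrite !sum_Sn; change (@plus _) with Rplus.
    assert (A := HM (S m) t).
    apply Rle_trans with
      (Rabs (sum_n (fun k => f k t) m - sum_n (fun k => f k t) n) + Rabs (f (S m) t)).
    + eapply Rle_trans; [right | apply Rabs_triang]; f_equal; ring.
    + lra. }
apply continuity_pt_filterlim.
apply (CVU_cont_open (fun n t => sum_n (fun k => f k t) n) (fun _ => True)).
- apply open_true.
- apply CVU_dom_cauchy; intros eps.
  assert (L : ex_finite_lim_seq (sum_n M)) by exact EM.
  apply ex_lim_seq_cauchy_corr in L; destruct (L eps) as [N HN].
  exists N; intros n m t _ Hn Hm; specialize (HN n m Hn Hm).
  apply Rle_lt_trans with (2 := HN).
  destruct (Nat.le_ge_cases n m) as [Hnm | Hnm].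
  + rewrite Rabs_minus_sym, (Rabs_minus_sym (sum_n M n)).
    apply Rle_trans with (2 := Rle_abs _); now apply T.
  + apply Rle_trans with (2 := Rle_abs _); now apply T.
- intros n t _; apply continuity_pt_filterlim.
  induction n as [| n IH].
  + apply continuous_ext with (f := f O); [intros s; now rewrite sum_O | apply Hc].
  + apply continuous_ext with (f := fun s => plus (sum_n (fun k => f k s) n) (f (S n) s)).
    * intros s; now rewrite sum_Sn.
    * apply (continuous_plus (fun s => sum_n (fun k => f k s) n)); [exact IH | apply Hc].
- exact I.
Qed.

Lemma continuous_K (x : R) : continuous K x.
Proof.
apply continuous_ext with (f := zigzag_series); [intros t; now rewrite K_eq |].
apply (continuous_Series (fun n t => (/ 3) ^ n * zigzag (3 ^ n * t))
         (fun n => (/ 3) ^ n)).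
- intros n t; apply zigzag_term_bound.
- apply ex_series_geom; rewrite Rabs_pos_eq; lra.
- intros n t; apply (continuous_scal_r ((/ 3) ^ n) (fun t => zigzag (3 ^ n * t))).
  apply (continuous_comp (fun t => 3 ^ n * t) zigzag).
  + apply (ex_derive_continuous (fun t => 3 ^ n * t)); auto_derive; auto.
  + apply interpolate_continuous.
Qed.

(** * Slopes over triadic intervals *)

(** One third of the slope of K over the k-th interval of level n, an integer
    ([K_triadic_increment]). *)
Fixpoint slope (n : nat) (k : Z) : Z :=
  match n with
  | O => 0
  | S n => (slope n (k / 3) + zig_step k)%Z
  end.

(** The steps 1 and -2 of the zigzag agree modulo 3, so the residue of a slope
    does not depend on the interval but only on its level. *)
Lemma slope_mod_3 (n : nat) (k : Z) : (slope n k mod 3 = Z.of_nat n mod 3)%Z.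
Proof.
revert k; induction n as [| n IH]; intros k; [reflexivity |].
simpl slope; rewrite Nat2Z.inj_succ, <- Z.add_1_r.
rewrite Z.add_mod, IH, (Z.add_mod (Z.of_nat n)) by lia.
now destruct (zig_step_cases k) as [-> | ->].
Qed.

(** At a = 1/3 all factors of the rise equal 1/3 and their derivatives are the
    zigzag steps, so the logarithmic derivative is three times the sum of the
    steps, which is [slope]. *)
Lemma is_derive_rise (n : nat) (k : Z) :
  rise (1 / 3) n k = / 3 ^ n /\
  is_derive (fun a => rise a n k) (1 / 3) (3 * IZR (slope n k) / 3 ^ n).
Proof.
revert k; induction n as [| n IH]; intros k.
- split; [rewrite rise_0; simpl; field |].
  apply (is_derive_ext (fun _ => 1)); [intros a; now rewrite rise_0 |].
  replace (3 * IZR (slope 0 k) / 3 ^ 0) with 0 by (simpl; field).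
  apply (is_derive_const 1).
- destruct (IH (k / 3)%Z) as [V D]; assert (P := pow3_pos n); split.
  + rewrite rise_S, V; simpl pow; field; lra.
  + apply (is_derive_ext
      (fun a => (1 / 3 + (a - 1 / 3) * IZR (zig_step k)) * rise a n (k / 3)));
      [intros a; now rewrite rise_S |].
    evar_last.
    * apply (is_derive_mult (fun a => 1 / 3 + (a - 1 / 3) * IZR (zig_step k))
               (fun a => rise a n (k / 3)) (1 / 3) (IZR (zig_step k))
               (3 * IZR (slope n (k / 3)) / 3 ^ n)).
      -- auto_derive; [exact I | ring].
      -- exact D.
      -- intros; apply Rmult_comm.
    * rewrite V; unfold plus, mult; simpl; rewrite plus_IZR; field; lra.
Qed.

(** The construction never changes a value at a grid point: at later levels
    3^m x is an integer there, where the zigzag vanishes. *)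
Lemma okamoto_triadic (a : R) (n : nat) (k : Z) :
  okamoto a (triadic n k) = okamoto_approx a n (triadic n k).
Proof.
unfold okamoto.
rewrite (Lim_seq_ext_loc _ (fun _ => okamoto_approx a n (triadic n k))).
- now rewrite Lim_seq_const.
- exists n; intros m Hm; induction Hm as [| m Hm IH]; [reflexivity |].
  rewrite <- IH; apply Rminus_diag_uniq; rewrite approx_S_sub.
  replace (3 ^ m * triadic n k) with (IZR (3 ^ Z.of_nat (m - n) * k)).
  + rewrite zigzag_IZR; ring.
  + rewrite mult_IZR, <- pow_IZR, <- (pow3_triadic n k), <- Rmult_assoc, <- pow_add.
    now replace (m - n + n)%nat with m by lia.
Qed.

Lemma K_triadic_increment (n : nat) (k : Z) :
  K (triadic n (k + 1)) - K (triadic n k) = 3 * IZR (slope n k) / 3 ^ n.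
Proof.
rewrite !K_eq.
rewrite <- (is_derive_unique _ _ _ (proj2 (is_derive_rise n k))).
symmetry; apply is_derive_unique.
apply (is_derive_ext
  (fun a => minus (okamoto a (triadic n (k + 1))) (okamoto a (triadic n k)))).
- intros a; now rewrite !okamoto_triadic.
- apply (is_derive_minus (fun a => okamoto a (triadic n (k + 1)))
           (fun a => okamoto a (triadic n k))); apply is_derive_okamoto.
Qed.

(** A derivative controls the difference quotients between any two points on
    either side of x, not only those based at x: add the estimates for the two
    halves.  Either u or v may be x itself, which covers the endpoints of D. *)
Lemma derive_within_straddle (D : R -> Prop) (f : R -> R) (x l eps : R) :
  is_derive_within D f x l -> 0 < eps ->
  exists delta, 0 < delta /\
    forall u v, D u -> D v -> u <= x <= v -> v - u < delta ->
      Rabs (f v - f u - l * (v - u)) <= eps * (v - u).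
Proof.
intros H Heps.
destruct (proj1 (filterlim_locally _ _) H (mkposreal _ Heps)) as [d Hd].
assert (Q : forall t, D t -> Rabs (t - x) < d ->
  Rabs (f t - f x - l * (t - x)) <= eps * Rabs (t - x)).
{ intros t Dt Ht.
  destruct (Req_dec t x) as [-> | Hne].
  - rewrite !Rminus_diag, Rmult_0_r, Rminus_diag, Rabs_R0; lra.
  - assert (t0 : t - x <> 0) by lra.
    assert (B : ball l eps ((f (x + (t - x)) - f x) / (t - x))).
    { apply Hd.
      - change (Rabs (t - x - 0) < d); now rewrite Rminus_0_r.
      - split; [exact t0 |]; now replace (x + (t - x)) with t by ring. }
    change (Rabs ((f (x + (t - x)) - f x) / (t - x) - l) < eps) in B.
    replace (x + (t - x)) with t in B by ring.
    replace (f t - f x - l * (t - x))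
      with (((f t - f x) / (t - x) - l) * (t - x)) by (field; exact t0).
    rewrite Rabs_mult; apply Rmult_le_compat_r; [apply Rabs_pos | lra]. }
exists d; split; [apply cond_pos |].
intros u v Du Dv [Hu Hv] Huv.
assert (Au : Rabs (u - x) = x - u).
{ rewrite Rabs_minus_sym; apply Rabs_pos_eq; lra. }
assert (Av : Rabs (v - x) = v - x) by (apply Rabs_pos_eq; lra).
assert (Qu := Q u Du); assert (Qv := Q v Dv); rewrite Au in Qu; rewrite Av in Qv.
specialize (Qu ltac:(lra)); specialize (Qv ltac:(lra)).
apply Rabs_le_between in Qu; apply Rabs_le_between in Qv.
apply Rabs_le; lra.
Qed.

(** Closed intervals are needed at x = 1, where the last interval of the level
    is taken. *)
Lemma triadic_interval (n : nat) (x : R) :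
  unit_interval x ->
  exists k, triadic n k <= x <= triadic n (k + 1) /\
    unit_interval (triadic n k) /\ unit_interval (triadic n (k + 1)).
Proof.
intros [H0 H1]; assert (P := pow3_pos n).
set (N := (3 ^ Z.of_nat n)%Z).
assert (EN : IZR N = 3 ^ n) by (symmetry; apply pow_IZR).
assert (HN : (0 < N)%Z) by (apply lt_IZR; lra).
assert (W : forall j, (0 <= j <= N)%Z -> unit_interval (triadic n j)).
{ intros j [J0 J1]; apply IZR_le in J0; apply IZR_le in J1.
  split; [apply triadic_le; lra | apply le_triadic; lra]. }
destruct (Rle_lt_or_eq_dec _ _ H1) as [Hlt | ->].
- destruct (base_Int_part (3 ^ n * x)) as [B1 B2].
  set (k := Int_part (3 ^ n * x)) in *; exists k.
  assert (K0 : (0 <= k)%Z).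
  { assert (X0 : 0 <= 3 ^ n * x) by (apply Rmult_le_pos; lra).
    assert (L : (-1 < k)%Z) by (apply lt_IZR; lra); lia. }
  assert (KN : (k < N)%Z).
  { assert (X1 := Rmult_lt_compat_l _ _ _ P Hlt); apply lt_IZR; lra. }
  split; [split | split; apply W; lia].
  + apply le_triadic; lra.
  + apply triadic_le; rewrite plus_IZR; lra.
- exists (N - 1)%Z; split; [split | split; apply W; lia].
  + apply le_triadic; rewrite minus_IZR; lra.
  + apply triadic_le; rewrite plus_IZR, minus_IZR; lra.
Qed.

Theorem theorem2p4 :
  continuous_on unit_interval K /\
  forall x : R, unit_interval x ->
    ~ (exists l : R, is_derive_within unit_interval K x l).
Proof.
split; [apply continuous_on_forall; intros x _; apply continuous_K |].
intros x Hx [l Hl].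
destruct (derive_within_straddle _ _ _ _ 1 Hl Rlt_0_1) as (d & Hd & Q).
destruct (pow_lt_1_zero (/ 3)) with (y := d) as [n0 Hn0];
  [rewrite Rabs_pos_eq; lra | exact Hd |].
assert (T : forall n, (n0 <= n)%nat ->
          exists k, Rabs (3 * IZR (slope n k) - l) <= 1).
{ intros n Hn; destruct (triadic_interval n x Hx) as (k & Hk & U & V); exists k.
  assert (P := pow3_pos n).
  assert (P' : 0 < / 3 ^ n) by now apply Rinv_0_lt_compat.
  assert (W : triadic n (k + 1) - triadic n k = / 3 ^ n).
  { unfold triadic; rewrite plus_IZR; field; lra. }
  assert (A := Hn0 n Hn); rewrite pow_inv, Rabs_pos_eq in A by lra.
  specialize (Q _ _ U V Hk); rewrite K_triadic_increment, W in Q.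
  specialize (Q A).
  replace (3 * IZR (slope n k) / 3 ^ n - l * / 3 ^ n)
    with ((3 * IZR (slope n k) - l) * / 3 ^ n) in Q by (field; lra).
  rewrite Rabs_mult, (Rabs_pos_eq (/ 3 ^ n)) in Q by lra.
  now apply Rmult_le_reg_r in Q. }
destruct (T n0) as [k Hk]; [lia |].
destruct (T (S n0)) as [k' Hk']; [lia |].
apply Rabs_le_between in Hk; apply Rabs_le_between in Hk'.
(* 3 s and 3 s' both lie within 1 of l, so the integers s and s' coincide. *)
assert (E : slope n0 k = slope (S n0) k').
{ assert (L : (-1 < slope n0 k - slope (S n0) k' < 1)%Z).
  { split; apply lt_IZR; rewrite minus_IZR; lra. }
  lia. }
assert (M := slope_mod_3 n0 k); rewrite E, slope_mod_3, Nat2Z.inj_succ in M.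
generalize (Z.mod_pos_bound (Z.of_nat n0) 3); revert M.
Z.div_mod_to_equations; lia.
Qed.
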